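(* Let $(R,\mathfrak m,k)$ be a commutative noetherian local ring. The following assertions hold. (a) If $I$ is a non-zero proper ideal of $R$ that is a direct summand of $\mathfrak m$ (as an $R$-module), then the inclusion map $I\to R$ is an irreducible homomorphism. (b) Assume that $R$ is Henselian, and let $\phi\colon M\to F$ be an irreducible monomorphism of finitely generated $R$-modules with $F$ free such that $\operatorname{Im}(\phi)\subseteq \mathfrak m F$. Then the following hold. (b1) The $R$-module $M$ is isomorphic to a direct summand of $\mathfrak m$. (b2) If $M$ is indecomposable, then for every surjective $R$-homomorphism $\pi\colon F\to R$ there exists a split monomorphism $\eta\colon M\to\mathfrak m$ such that $\pi\phi=\theta\eta$, where $\theta\colon\mathfrak m\to R$ is the inclusion map.
   Context: All modules are finitely generated. A homomorphism $f\colon M\to N$ of finitely generated $R$-modules is called irreducible if $f$ is neither a split monomorphism nor a split epimorphism, and for every factorization $f=hg$ with $g\colon M\to L$, $h\colon L\to N$ homomorphisms and $L$ a finitely generated $R$-module, either $g$ is a split monomorphism or $h$ is a split epimorphism. An irreducible monomorphism is an irreducible homomorphism that is injective. *)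

(* Defs.v *)
(* Submodules and ideals are boolean predicates; under classical logic with
   choice these are all submodules and ideals. *)
From HB Require Import structures.
From mathcomp Require Import all_boot all_algebra.

Set Implicit Arguments.
Unset Strict Implicit.
Unset Printing Implicit Defensive.

Import GRing.Theory.
Local Open Scope ring_scope.

(* The submodule S of V regarded as an R-module in its own right.  Ideals of R
   are the submodules of the regular module R^o. *)
Record submod (R : pzRingType) (V : lmodType R) (S : submodClosed V) :=
  Submod { submod_val :> V; _ : submod_val \in S }.

HB.instance Definition _ (R : pzRingType) (V : lmodType R)
  (S : submodClosed V) := [isSub for @submod_val R V S].
HB.instance Definition _ (R : pzRingType) (V : lmodType R)
  (S : submodClosed V) := [Choice of submod S by <:].
HB.instance Definition _ (R : pzRingType) (V : lmodType R)
  (S : submodClosed V) := [SubChoice_isSubLmodule of submod S by <:].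

Definition inclusion (R : pzRingType) (V : lmodType R) (S : submodClosed V) :
  {linear submod S -> V} := \val.

Section Modules.
Variable R : comNzRingType.

Definition fin_gen (M : lmodType R) : Prop :=
  exists (n : nat) (g : 'I_n -> M),
    forall x : M, exists c : 'I_n -> R, x = \sum_(i < n) c i *: g i.

Definition finite_free (F : lmodType R) : Prop :=
  exists (n : nat) (f : {linear F -> 'rV[R]_n}), bijective f.

Definition isomorphic (M N : lmodType R) : Prop :=
  exists f : {linear M -> N}, bijective f.

Definition split_mono (M N : lmodType R) (f : {linear M -> N}) : Prop :=
  exists r : {linear N -> M}, cancel f r.

Definition split_epi (M N : lmodType R) (f : {linear M -> N}) : Prop :=
  exists s : {linear N -> M}, cancel s f.

Definition surjective_linear (M N : lmodType R) (f : {linear M -> N}) : Prop :=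
  forall y : N, exists x : M, f x = y.

Definition irreducible_hom (M N : lmodType R) (f : {linear M -> N}) : Prop :=
  [/\ fin_gen M, fin_gen N, ~ split_mono f, ~ split_epi f
    & forall (L : lmodType R) (g : {linear M -> L}) (h : {linear L -> N}),
        fin_gen L -> (forall x : M, f x = h (g x)) ->
        split_mono g \/ split_epi h].

(* B is the internal direct sum of A and C. *)
Definition internal_dsum (V : lmodType R) (A C B : submodClosed V) : Prop :=
  (forall x : V, x \in B <-> exists a c : V, [/\ a \in A, c \in C & x = a + c])
  /\ (forall x : V, x \in A -> x \in C -> x = 0).

Definition direct_summand (V : lmodType R) (A B : submodClosed V) : Prop :=
  exists C : submodClosed V, internal_dsum A C B.

Definition indecomposable (M : lmodType R) : Prop :=
  (exists x : M, x != 0) /\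
  forall A B : submodClosed M,
    (forall x : M, exists a b : M, [/\ a \in A, b \in B & x = a + b]) ->
    (forall x : M, x \in A -> x \in B -> x = 0) ->
    (forall x : M, x \in A -> x = 0) \/ (forall x : M, x \in B -> x = 0).

(* Membership in the product I F of an ideal and a module. *)
Definition in_ideal_mul (I : submodClosed R^o) (F : lmodType R) (y : F) : Prop :=
  exists (n : nat) (a : 'I_n -> R) (x : 'I_n -> F),
    (forall i, a i \in I) /\ y = \sum_(i < n) a i *: x i.

Definition noetherian : Prop :=
  forall I : submodClosed R^o, fin_gen (submod I).

Definition maximal_ideal (I : submodClosed R^o) : Prop :=
  1 \notin I /\
  forall J : submodClosed R^o,
    1 \notin J -> {subset I <= J} -> {subset J <= I}.

(* (R, m, k) is a local ring; the residue field k = R / m is given through its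
   projection, a surjective ring morphism with kernel m. *)
Definition local_ring (m : submodClosed R^o) (k : fieldType)
    (res : {rmorphism R -> k}) : Prop :=
  [/\ maximal_ideal m,
      forall J : submodClosed R^o, maximal_ideal J -> J =i m,
      forall a : k, exists x : R, res x = a
    & forall x : R, x \in m <-> res x = 0].

(* Hensel's lemma holds: coprime monic factorizations over the residue field of
   (the reduction of) a monic polynomial lift to R. *)
Definition henselian (k : fieldType) (res : {rmorphism R -> k}) : Prop :=
  forall (f : {poly R}) (g0 h0 : {poly k}),
    f \is monic -> g0 \is monic -> h0 \is monic -> coprimep g0 h0 ->
    map_poly res f = g0 * h0 ->
    exists g h : {poly R},
      [/\ g \is monic, h \is monic, f = g * h,
          map_poly res g = g0 & map_poly res h = h0].

End Modules.

(* Main.v *)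
Require Import Defs.
From HB Require Import structures.
From mathcomp Require Import all_boot all_algebra.
From mathcomp Require Import boolp classical_sets.

Set Implicit Arguments.
Unset Strict Implicit.
Unset Printing Implicit Defensive.

Import GRing.Theory.
Local Open Scope ring_scope.

(** Both halves of the theorem come from testing irreducibility on well-chosen
    factorizations, using that a linear map into R either hits 1, and then
    splits, or has its image in the maximal ideal m.

    In the first half, let m be the direct sum of I and C, and let the
    inclusion of I in R factor as h after g : I -> L.  If h hits 1 it is a split
    epimorphism.  Otherwise h lands in m, and h followed by the projection
    m -> I is a retraction of g.  The inclusion itself is not a split
    monomorphism: a retraction r : R -> I gives x (1 - r 1) = 0 for x in I,
    where 1 - r 1 is invertible because r 1 is in m.

    In the second half, fix a surjection pi : F -> R and e with pi e = 1.
    As phi maps M into m F, the composite pi phi factors through eta : M -> m.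
    Factor phi through m x F by
        g x = (eta x, phi x)   and   h (z, y) = y + (z - pi y) e.
    Since pi (h (z, y)) = z is in m, the map h is not surjective, so g is split
    by some r = (r1, r2), that is r1 eta = 1 - t with t = r2 phi.  Now t maps M
    into m M, so 1 - t has a linear left inverse u (id_minus_left_invertible,
    a form of Nakayama's lemma obtained from the Cayley-Hamilton theorem), and
    u r1 is a retraction of eta.  Thus eta is a split monomorphism for every
    surjection pi (irreducible_mono_component).  Splitting m as the image of
    eta plus the kernel of its retraction shows that M is isomorphic to a
    direct summand of m; a surjection pi exists because F is not 0, as
    otherwise M = 0 and phi would split. *)

(** * Building submodules and linear maps from propositions *)

Lemma exists_submod (R : pzRingType) (V : lmodType R) (P : V -> Prop) :
  P 0 -> (forall a u v, P u -> P v -> P (a *: u + v)) ->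
  exists S : submodClosed V, forall x, x \in S <-> P x.
Proof.
move=> P0 PD; pose p := [pred x | `[< P x >]].
have pE x : x \in p <-> P x.
  by rewrite inE; split=> [/asboolP|Px] //; apply/asboolP.
have p_closed : submod_closed p.
  by split=> [|a u v /pE Pu /pE Pv]; apply/pE => //; apply: PD.
pose S : submodClosed V := HB.pack (p : {pred V})
  (GRing.isSubmodClosed.Build R V p p_closed).
by exists S => x; rewrite -pE.
Qed.

Lemma exists_linear (R : pzRingType) (U V : lmodType R) (f : U -> V) :
  linear f -> exists g : {linear U -> V}, g =1 f.
Proof.
move=> f_lin.
pose g : {linear U -> V} := HB.pack f (GRing.isLinear.Build R U V _ f f_lin).
by exists g.
Qed.

Lemma corestriction (R : pzRingType) (U V : lmodType R) (S : submodClosed V)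
    (f : {linear U -> V}) :
  (forall x, f x \in S) ->
  exists g : {linear U -> submod S}, forall x, inclusion S (g x) = f x.
Proof.
move=> fS.
have [|g gE] := @exists_linear R U (submod S) (fun x => Submod (fS x)).
  by move=> a x y; apply: val_inj; rewrite /= linearP.
by exists g => x; rewrite gE.
Qed.

Lemma submod_subr (R : pzRingType) (V : lmodType R) (S : submodClosed V) x y :
  x \in S -> y \in S -> x - y \in S.
Proof.
exact: (GRing.submod_closedB (GRing.submodClosedP S)).2.
Qed.

Section Modules.
Variable R : comNzRingType.

(** * Direct summands *)

(** The projection is pinned down only on A, where it is the identity: this is
    what a retraction has to satisfy. *)
Lemma summand_projection (V : lmodType R) (A B : submodClosed V) :
  direct_summand A B ->
  exists p : {linear submod B -> submod A},
    forall (x : submod B) (a : submod A),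
      inclusion B x = inclusion A a -> p x = a.
Proof.
move=> [C [ABC AC0]].
have /choice [p pP] (x : submod B) :
    exists a : submod A, inclusion B x - inclusion A a \in C.
  have [a [c [aA cC xE]]] := (ABC _).1 (valP x).
  by exists (Submod aA); rewrite /= xE addrAC subrr add0r.
have p_uniq x (a : submod A) : inclusion B x - inclusion A a \in C -> p x = a.
  move=> xaC; apply: val_inj; apply/eqP; rewrite -subr_eq0; apply/eqP.
  apply: AC0; first exact: submod_subr (valP (p x)) (valP a).
  by have := submod_subr xaC (pP x); rewrite opprB addrC addrA subrK.
have [|q qE] := @exists_linear R (submod B) (submod A) p.
  move=> a x y; apply: p_uniq; rewrite !(linearP (inclusion _)) opprD.
  by rewrite addrACA -scalerBr rpredD // rpredZ.
by exists q => x a xa; rewrite qE; apply: p_uniq; rewrite xa subrr rpred0.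
Qed.

(** The complement of the image of [eta] is the kernel of a retraction of
    [eta]; the same retraction, restricted to the image, inverts [eta]. *)
Lemma split_mono_summand (V M : lmodType R) (B : submodClosed V)
    (eta : {linear M -> submod B}) :
  split_mono eta ->
  exists A : submodClosed V, direct_summand A B /\ isomorphic M (submod A).
Proof.
move=> [r etaK].
have [||A AE] := @exists_submod R V
    (fun v => exists x, v = inclusion B (eta x)).
- by exists 0; rewrite !linear0.
- by move=> a _ _ [x ->] [y ->]; exists (a *: x + y); rewrite !linearP.
have [||C CE] := @exists_submod R V
    (fun v => exists2 z, v = inclusion B z & r z = 0).
- by exists 0; rewrite linear0.
- move=> a _ _ [x -> rx] [y -> ry].
  exists (a *: x + y); first by rewrite linearP.
  by rewrite linearP rx ry scaler0 addr0.
exists A; split.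
  exists C; split=> [v|v /AE[x ->] /CE[z /val_inj <-]]; last first.
    by rewrite etaK => ->; rewrite !linear0.
  split=> [vB|[_ [_ [/AE[x ->] /CE[z -> _] ->]]]]; last first.
    by rewrite rpredD ?(valP (eta x)) ?(valP z).
  pose z : submod B := Submod vB.
  exists (inclusion B (eta (r z))), (inclusion B (z - eta (r z))).
  split; [by apply/AE; exists (r z) | apply/CE | ]; last first.
    by rewrite linearB addrC subrK.
  by exists (z - eta (r z)); rewrite // linearB etaK subrr.
have [|f fE] := @corestriction R M V A (inclusion B \o eta).
  by move=> x; apply/AE; exists x.
have [|i iE] := @corestriction R (submod A) V B (inclusion A).
  by move=> a; have /AE[x /= ->] := valP a; apply: valP.
have fK : cancel f (r \o i).
  move=> x /=; rewrite -[RHS]etaK; congr (r _); apply: val_inj.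
  by rewrite -[LHS]/(inclusion B _) iE fE.
exists f; exists (r \o i) => // a.
have /AE[x aE] := valP a.
have -> : a = f x by apply: val_inj; rewrite -[RHS]/(inclusion A _) fE.
by rewrite fK.
Qed.

(** * Maps to the ring, ideal multiples and products *)

Lemma linear_cyclic (L : lmodType R) (l : L) :
  exists s : {linear R^o -> L}, forall a, s a = a *: l.
Proof.
by apply: exists_linear => a x y; rewrite scalerDl scalerA.
Qed.

Lemma split_epi_onto_ring (L : lmodType R) (h : {linear L -> R^o}) (l : L) :
  h l = 1 -> split_epi h.
Proof.
move=> hl; have [s sE] := linear_cyclic l.
by exists s => a; rewrite sE linearZ hl; apply: mulr1.
Qed.

Lemma in_ideal_mul_linear (I : submodClosed R^o) (F G : lmodType R)
    (f : {linear F -> G}) y : in_ideal_mul I y -> in_ideal_mul I (f y).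
Proof.
move=> [n [a [x [aI ->]]]]; exists n, a, (f \o x); split=> //.
by rewrite linear_sum; apply: eq_bigr => i _; rewrite linearZ.
Qed.

Lemma in_ideal_mul_ring (I : submodClosed R^o) (y : R^o) :
  in_ideal_mul I y -> y \in I.
Proof.
move=> [n [a [x [aI ->]]]]; apply: rpred_sum => i _.
by rewrite [_ *: _]mulrC; apply: (rpredZ (x i : R)).
Qed.

Lemma fin_gen_prod (M N : lmodType R) :
  fin_gen M -> fin_gen N -> fin_gen (M * N)%type.
Proof.
move=> [n [g gP]] [n' [g' gP']].
exists (n + n')%N, (fun i => match split i with
  | inl j => (g j, 0) | inr j => (0, g' j) end) => -[x y].
have [c ->] := gP x; have [c' ->] := gP' y.
exists (fun i => match split i with inl j => c j | inr j => c' j end).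
have sumE (I : finType) (u : I -> M) (v : I -> N) :
    \sum_i (u i, v i) = (\sum_i u i, \sum_i v i).
  by elim/big_ind3: _ => // ? ? ? ? ? ? -> ->.
have -> : (\sum_i c i *: g i, \sum_i c' i *: g' i) =
    \sum_i (c i *: g i, 0) + \sum_i (0, c' i *: g' i).
  by rewrite !sumE !big1_eq; congr pair; rewrite ?addr0 ?add0r.
rewrite big_split_ord; congr (_ + _); apply: eq_bigr => i _.
  by rewrite (unsplitK (inl i)); congr pair; rewrite scaler0.
by rewrite (unsplitK (inr i)); congr pair; rewrite scaler0.
Qed.

Lemma linear_pair (U V W : lmodType R) (r : {linear (U * V)%type -> W}) :
  exists (r1 : {linear U -> W}) (r2 : {linear V -> W}),
    forall u v, r (u, v) = r1 u + r2 v.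
Proof.
have [|r1 r1E] := @exists_linear R U W (fun u => r (u, 0)).
  move=> a x y; rewrite -[RHS]linearP; congr (r _).
  by congr pair; rewrite /= scaler0 addr0.
have [|r2 r2E] := @exists_linear R V W (fun v => r (0, v)).
  move=> a x y; rewrite -[RHS]linearP; congr (r _).
  by congr pair; rewrite /= scaler0 addr0.
exists r1, r2 => u v; rewrite r1E r2E -linearD; congr (r _).
by congr pair; rewrite /= ?addr0 ?add0r.
Qed.

(** * The Cayley-Hamilton theorem and local rings *)

(** Let A be a matrix of [t] on generators, chi its characteristic polynomial,
    and chi(X) - chi(1) = q(X) (X - 1).  Evaluating at [t], which kills chi,
    gives chi(1) = q(t) (1 - t), so q(t) / chi(1) is a left inverse of 1 - t.
    Because M need not be free, the computation takes place among row vectors,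
    where the Cayley-Hamilton theorem applies to A, and is carried to M along
    v |-> sum of the v_i g_i, which turns multiplication by A into [t]. *)
Lemma left_inverse_of_char_poly (M : lmodType R) (t : {linear M -> M})
    (n : nat) (g : 'I_n.+1 -> M) (A : 'M[R]_n.+1) (b : R) :
  (forall x, exists c : 'I_n.+1 -> R, x = \sum_i c i *: g i) ->
  (forall i, t (g i) = \sum_j A i j *: g j) ->
  b * (char_poly A).[1] = 1 ->
  exists u : {linear M -> M}, forall x, u (x - t x) = x.
Proof.
move=> g_gen tg bK.
have rt : root (char_poly A - (char_poly A).[1]%:P) 1.
  by rewrite /root !hornerE subrr.
have [q qE] := factor_theorem _ _ rt.
pose e (v : 'rV[R]_n.+1) := \sum_i v 0 i *: g i.
have eP a v w : e (a *: v + w) = a *: e v + e w.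
  rewrite /e scaler_sumr -big_split; apply: eq_bigr => i _.
  by rewrite !mxE scalerDl scalerA.
have [E EE] := exists_linear eP.
have te v : t (E v) = E (v *m A).
  rewrite !EE /e linear_sum.
  under eq_bigr do rewrite linearZ tg /= scaler_sumr.
  rewrite exchange_big; apply: eq_bigr => j _ /=.
  by rewrite mxE scaler_suml; apply: eq_bigr => i _; rewrite scalerA.
have iter_te i v : iter i t (E v) = E (v *m A ^+ i).
  elim: i => [|i IHi]; first by rewrite expr0 mulmx1.
  by rewrite iterS IHi te exprSr -mulmxA.
have iter_lin i a x y : iter i t (a *: x + y) = a *: iter i t x + iter i t y.
  by elim: i => //= i ->; rewrite linearP.
have [|u uE] := @exists_linear R M M
    (fun x => b *: \sum_(i < size q) q`_i *: iter i t x).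
  move=> a x y; rewrite scalerA mulrC -scalerA -scalerDr; congr (_ *: _).
  rewrite scaler_sumr -big_split; apply: eq_bigr => i _ /=.
  by rewrite iter_lin scalerDr !scalerA mulrC.
exists u => x.
have [v ->] : exists v, x = E v.
  have [c ->] := g_gen x; exists (\row_i c i).
  by rewrite EE; apply: eq_bigr => i _; rewrite mxE.
have qA : horner_mx A q = \sum_(i < size q) q`_i *: A ^+ i.
  rewrite -[in LHS](coefK q) poly_def linear_sum; apply: eq_bigr => i _.
  by rewrite linearZ /= rmorphXn /= horner_mx_X.
have uEv w : u (E w) = E (b *: (w *m horner_mx A q)).
  rewrite uE linearZ /= qA mulmx_sumr [in RHS]linear_sum /=; congr (_ *: _).
  by apply: eq_bigr => i _; rewrite iter_te -scalemxAr linearZ.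
rewrite te -linearB uEv; congr (E _).
have := congr1 (horner_mx A) qE.
rewrite mulrC rmorphB rmorphM rmorphB /= Cayley_Hamilton.
rewrite horner_mx_X !horner_mx_C => /(congr1 -%R).
rewrite sub0r opprK -mulNr opprB => qE'.
rewrite -{1}[v]mulmx1 -mulmxBr -mulmxA.
have -> : (1%:M - A) *m horner_mx A q = (char_poly A).[1]%:M by rewrite qE'.
by rewrite mul_mx_scalar scalerA bK scale1r.
Qed.

(** Zorn's lemma for the proper ideals containing J; a union of a chain of
    proper ideals is proper because it still misses 1. *)
Lemma exists_maximal_above (J : submodClosed R^o) :
  1 \notin J -> exists2 I : submodClosed R^o, maximal_ideal I & {subset J <= I}.
Proof.
move=> J1.
pose T := {I : submodClosed R^o | 1 \notin I /\ {subset J <= I}}.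
pose le (s t : T) := `[< {subset sval s <= sval t} >].
have leP s t : le s t <-> {subset sval s <= sval t} by split=> /asboolP.
have [||C C_chain|[I [I1 JI]] I_max] :=
    @ZL_preorder T (exist _ J (conj J1 (fun _ => id))) le.
- by move=> s; apply/leP.
- by move=> r s t /leP rs /leP st; apply/leP => x /rs /st.
(* A nonempty chain is bounded by its union, the empty chain by J itself. *)
- have [[s0 Cs0]|C0] := pselect (exists s, C s); last first.
    by exists (exist _ J (conj J1 (fun _ => id))) => s Cs; case: C0; exists s.
  have [||U UE] := @exists_submod R R^o
      (fun x => exists2 s, C s & x \in sval s).
  + by exists s0; rewrite ?rpred0.
  + move=> a x y [s Cs xs] [t Ct yt].
    have [/leP st|/leP ts] := C_chain s t Cs Ct.
      by exists t => //; rewrite rpredD // rpredZ // st.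
    by exists s => //; rewrite rpredD // ?rpredZ // ts.
  have U1 : 1 \notin U.
    by apply/negP => /UE[s _ s1]; have [/negP] := svalP s.
  have JU : {subset J <= U}.
    by move=> x xJ; apply/UE; exists s0 => //; have [_] := svalP s0; apply.
  exists (exist _ U (conj U1 JU)) => s Cs.
  by apply/leP => x xs; apply/UE; exists s.
exists I => //; split=> // I' I'1 II'.
have JI' : {subset J <= I'} by move=> x /JI /II'.
pose I's : T := exist _ I' (conj I'1 JI').
by have /leP := I_max I's ((leP (exist _ I (conj I1 JI)) I's).2 II').
Qed.

Section Local.
Variables (m : submodClosed R^o) (k : fieldType) (res : {rmorphism R -> k}).
Hypothesis localR : local_ring m res.

Lemma proper_ideal_sub (J : submodClosed R^o) : 1 \notin J -> {subset J <= m}.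
Proof.
move=> /exists_maximal_above[I I_max JI] x /JI.
by have [_ m_uniq _ _] := localR; rewrite (m_uniq _ I_max).
Qed.

(** The ideal generated by x is not contained in m, hence is not proper. *)
Lemma invertible_of_res (x : R) : res x != 0 -> exists b, b * x = 1.
Proof.
have [_ _ _ mE] := localR => /eqP res_x.
have [||J JE] := @exists_submod R R^o (fun y => exists b, b * x = y).
- by exists 0; rewrite mul0r.
- by move=> a _ _ [b <-] [c <-]; exists (a * b + c); rewrite mulrDl -mulrA.
apply/JE; apply: contrapT => /negP /proper_ideal_sub Jm; apply: res_x.
by apply/mE/Jm/JE; exists 1; rewrite mul1r.
Qed.

(** This replaces two steps of the usual argument at once: Nakayama's lemma,
    which makes 1 - t surjective, and the injectivity of surjective
    endomorphisms of finitely generated modules.  The matrix of [t] can be taken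
    with entries in m, so it vanishes in the residue field, where its
    characteristic polynomial is a power of X and takes the value 1 at 1. *)
Lemma id_minus_left_invertible (M : lmodType R) (t : {linear M -> M}) :
  fin_gen M -> (forall x, in_ideal_mul m (t x)) ->
  exists u : {linear M -> M}, forall x, u (x - t x) = x.
Proof.
move=> [[|n] [g g_gen]] tm.
  have M0 (x : M) : x = 0 by have [c ->] := g_gen x; rewrite big_ord0.
  by exists t => x; rewrite [LHS]M0 [RHS]M0.
have /choice [a aP] (i : 'I_n.+1) : exists a : 'I_n.+1 -> R,
    (forall j, a j \in m) /\ t (g i) = \sum_j a j *: g j.
  have [l [a [x [am ->]]]] := tm (g i).
  have /choice [c cP] j := g_gen (x j).
  exists (fun j => \sum_i a i * c i j); split=> [j|].
    by apply: rpred_sum => s _; rewrite mulrC; apply: (rpredZ (c s j)).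
  under eq_bigr do rewrite cP scaler_sumr.
  rewrite exchange_big; apply: eq_bigr => j _ /=.
  by rewrite scaler_suml; apply: eq_bigr => s _; rewrite scalerA.
pose A : 'M[R]_n.+1 := \matrix_(i, j) a i j.
have [_ _ _ mE] := localR.
have resA : map_mx res A = 0.
  by apply/matrixP => i j; rewrite !mxE; apply/mE; case: (aP i).
have [|b bK] := @invertible_of_res (char_poly A).[1].
  rewrite -horner_map rmorph1 /= map_char_poly resA /char_poly /char_poly_mx.
  by rewrite map_mx0 subr0 det_scalar hornerXn expr1n oner_neq0.
apply: (left_inverse_of_char_poly g_gen _ bK) => i.
by rewrite (aP i).2; apply: eq_bigr => j _; rewrite mxE.
Qed.

(** A section of [h] would put [e], hence 1 = pi e, in the image, although
    pi h takes its values in m. *)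
Lemma not_split_epi_into_maximal (L F : lmodType R) (h : {linear L -> F})
    (pi : {linear F -> R^o}) (e : F) :
  pi e = 1 -> (forall x, pi (h x) \in m) -> ~ split_epi h.
Proof.
move=> pie hm [s hs]; have [[/negP m1 _] _ _ _] := localR.
by apply: m1; rewrite -pie -(hs e).
Qed.

(** * The irreducible maps *)

Lemma irreducible_summand_inclusion (I : submodClosed R^o) :
  fin_gen (submod I) -> (exists2 x : R, x \in I & x != 0) -> 1 \notin I ->
  direct_summand I m -> irreducible_hom (inclusion I).
Proof.
move=> fgI [x xI x0] I1 Im.
have I_sub_m : {subset I <= m} by apply: proper_ideal_sub.
have [_ _ _ mE] := localR.
split.
- exact: fgI.
- exists 1, (fun _ => 1) => y; exists (fun _ => y).
  by rewrite big_ord1 [RHS]mulr1.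
(* By linearity a retraction r satisfies x = r x = x (r 1) for x in I. *)
- move=> [r rK]; pose e := inclusion I (r 1).
  have em : e \in m by apply/I_sub_m/(valP (r 1)).
  have [|b be] := @invertible_of_res (1 - e).
    by rewrite rmorphB rmorph1 (mE _).1 // subr0 oner_neq0.
  have xe : x * e = x.
    rewrite -[LHS]/(x *: inclusion I (r 1)) -!linearZ /= [_ *: _]mulr1.
    by rewrite -[X in r X]/(inclusion I (Submod xI)) rK.
  move/eqP: x0; apply; rewrite -[x]mul1r -be mulrAC -mulrA mulrBr mulr1.
  by rewrite xe subrr mulr0.
- move=> [s sK]; move/negP: I1; apply.
  by rewrite -(sK 1); apply: valP.
move=> L g h _ hgE.
have [[l hl]|not1] := pselect (exists l, h l = 1).
  by right; apply: split_epi_onto_ring hl.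
left.
have [||J JE] := @exists_submod R R^o (fun y => exists l, h l = y).
- by exists 0; rewrite linear0.
- by move=> a _ _ [y <-] [z <-]; exists (a *: y + z); rewrite linearP.
have J1 : 1 \notin J by apply/negP => /JE.
have [|h' h'E] := @corestriction R L R^o m h.
  by move=> l; apply: (proper_ideal_sub J1); apply/JE; exists l.
have [p pE] := summand_projection Im.
by exists (p \o h') => y; apply: pE; rewrite h'E -hgE.
Qed.

(** Only one component of [phi] is followed, the one along [pi]; the module F
    itself serves as the other factor of the test module, so that no complement
    of the line spanned by [e] has to be chosen. *)
Lemma irreducible_mono_component (M F : lmodType R) (phi : {linear M -> F})
    (pi : {linear F -> R^o}) :
  fin_gen (submod m) -> irreducible_hom phi ->
  (forall x, in_ideal_mul m (phi x)) -> surjective_linear pi ->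
  exists eta : {linear M -> submod m},
    split_mono eta /\ forall x, pi (phi x) = inclusion m (eta x).
Proof.
move=> fgm [fgM fgF _ _ phi_irr] phim pi_surj.
have [e pie] := pi_surj 1.
have [|eta etaE] := @corestriction R M R^o m (pi \o phi).
  move=> x; apply/in_ideal_mul_ring.
  exact: (in_ideal_mul_linear pi) (phim x).
exists eta; split=> [|x]; last by rewrite etaE.
pose L : lmodType R := (submod m * F)%type.
have [|g gE] := @exists_linear R M L (fun x => (eta x, phi x)).
  by move=> a x y; rewrite !linearP.
(* The correction along e makes pi h the first projection, and it vanishes on
   the image of g. *)
have [|h hE] := @exists_linear R L F
    (fun z => z.2 + (inclusion m z.1 - pi z.2) *: e).
  move=> a [y1 y2] [z1 z2]; rewrite (linearP pi) (linearP (inclusion m)) opprD.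
  by rewrite addrACA -scalerBr scalerDl -scalerA addrACA -scalerDr.
have [|x|[r rK]|] := phi_irr L g h.
- exact: fin_gen_prod fgm fgF.
- rewrite hE gE -[inclusion m _]/(inclusion m (eta x)) etaE.
  by rewrite subrr scale0r addr0.
- have [r1 [r2 r12E]] := linear_pair r.
  have [x|u uK] := @id_minus_left_invertible M (r2 \o phi) fgM.
  + exact: (in_ideal_mul_linear r2) (phim x).
  + exists (u \o r1) => x.
    by rewrite -[RHS]uK -[X in X - _]rK gE r12E /= addrK.
move=> /not_split_epi_into_maximal; case/(_ pi e pie) => z.
rewrite hE /= linearD linearZ /= pie -[_ *: _]/(_ * _) mulr1 addrC subrK.
exact: valP.
Qed.

End Local.
End Modules.

Theorem theorem1 (R : comNzRingType) (m : submodClosed R^o) (k : fieldType)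
    (res : {rmorphism R -> k})
    (noethR : noetherian R) (localR : local_ring m res) :
  (forall I : submodClosed R^o,
      (exists2 x : R, x \in I & x != 0) -> 1 \notin I ->
      direct_summand I m ->
      irreducible_hom (inclusion I))
  /\
  (henselian res ->
   forall (M F : lmodType R) (phi : {linear M -> F}),
     fin_gen M -> fin_gen F ->
     irreducible_hom phi -> injective phi -> finite_free F ->
     (forall x : M, in_ideal_mul m (phi x)) ->
     (exists A : submodClosed R^o,
         direct_summand A m /\ isomorphic M (submod A))
     /\
     (indecomposable M ->
      forall pi : {linear F -> R^o}, surjective_linear pi ->
        exists eta : {linear M -> submod m},
          split_mono eta /\ forall x : M, pi (phi x) = inclusion m (eta x))).
Proof.
split=> [I|_ M F phi _ _ phi_irr phi_inj freeF phim].
  exact: (irreducible_summand_inclusion localR (noethR I)).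
have component := irreducible_mono_component localR (noethR m) phi_irr phim.
split=> [|_]; last exact: component.
have [pi pi_surj] : exists pi : {linear F -> R^o}, surjective_linear pi.
  have [[|n] [f [f' fK f'K]]] := freeF.
    (* If F = 0 then M = 0 by injectivity, and the zero map splits phi. *)
    have [_ _ not_split _ _] := phi_irr; case: not_split.
    have [|r rE] := @exists_linear R F M (fun _ => 0).
      by move=> a x y; rewrite scaler0 addr0.
    exists r => x; apply: phi_inj; apply: (can_inj fK).
    by rewrite [LHS]thinmx0 [RHS]thinmx0.
  have [|pi piE] := @exists_linear R F R^o (fun y => f y 0 0).
    by move=> a x y; rewrite linearP !mxE.
  by exists pi => y; exists (f' (const_mx y)); rewrite piE f'K mxE.
have [eta [eta_split _]] := component pi pi_surj.
exact: split_mono_summand eta_split.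
Qed.
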